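(* Let $R,S$ be finite digraphs, let $\mathfrak{D}'$ be a class of finite digraphs, and let $\mathcal{E}(R),\mathcal{E}(S)$, $\phi_R,\phi_S$, $\alpha^R,\alpha^S$ be as in the context. Assume that ERD and AID hold. Let $\rho$ be an S-scheme from $R$ to $S$ with respect to $\mathfrak{D}'$, and put $\epsilon:=\alpha^S_{\mathcal{E}(R),\,\rho_{\mathcal{E}(R)}(\phi_R)}$. (1) The following are equivalent: - $\rho$ is induced by $\epsilon$ and $\epsilon$ fulfills Condition 1; - for all $G,H\in\mathfrak{D}'$, $\xi\in\mathcal{S}(G,R)$, $\zeta\in\mathcal{S}(H,R)$, $v\in V(G)$, $w\in V(H)$: $$\alpha^R_{G,\xi}(v)=\alpha^R_{H,\zeta}(w)\ \Longrightarrow\ \alpha^S_{G,\rho_G(\xi)}(v)=\alpha^S_{H,\rho_H(\zeta)}(w).\qquad(\ast\ast)$$ (2) Suppose that $\rho$ is induced by $\epsilon$, that $\epsilon$ fulfills Condition 1, and that for all $\mathfrak{a},\mathfrak{b}\in\mathcal{E}_o(R)$, $\epsilon(\mathfrak{a})=\epsilon(\mathfrak{b})$ implies $\phi_R(\mathfrak{a})=\phi_R(\mathfrak{b})$. Then $\rho$ is a strong S-scheme satisfying $(\ast\ast)$. (3) Suppose the hypotheses of (2) hold and, in addition, one of the following holds: - $\mathfrak{D}'=\mathfrak{D}$ and $R\in\mathfrak{D}$; - $\mathfrak{T}_a\subseteq\mathfrak{D}'\subseteq\mathfrak{D}$ and $R\in\mathfrak{T}_a$; - $\mathfrak{D}'=\mathfrak{P}$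 and $R\in\mathfrak{P}$; - $\mathfrak{D}'=\mathfrak{P}^*$ and $R\in\mathfrak{P}^*$. Then $\rho$ can be extended to a strong $\Gamma$-scheme $\rho'$ from $R$ to $S$ with respect to $\mathfrak{D}'$, meaning that $\rho'_G$ restricted to $\mathcal{S}(G,R)$ (with codomain $\mathcal{S}(G,S)$) equals $\rho_G$ for all $G\in\mathfrak{D}'$.
   Context: Digraphs $G=(V(G),A(G))$ have a finite nonempty vertex set and $A(G)\subseteq V(G)\times V(G)$; loops are allowed, and $vw$ denotes $(v,w)$. An arc $vw$ is proper if $v\ne w$, and $G^*$ is $G$ with all loops removed. A homomorphism $\xi:G\to H$ is a map with $\xi(v)\xi(w)\in A(H)$ for all $vw\in A(G)$. It is strict if, in addition, it maps proper arcs to proper arcs. $\mathcal{H}(G,H)$ and $\mathcal{S}(G,H)$ denote the sets of homomorphisms and of strict homomorphisms. Classes of digraphs: - $\mathfrak{D}$ is a representative system of the isomorphism classes of finite digraphs; $\mathfrak{D}'\subseteq\mathfrak{D}$, and constructed digraphs are tacitly identified with their representatives. - $\mathfrak{T}_a=\{G\in\mathfrak{D}: G^*\text{ has no closed walk}\}$. A closed walk is $v_0,\dots,v_I$ with $I\ge1$, $v_{i-1}v_i\in A$ for all $i$, and $v_0=v_I$. - $\mathfrak{P}$ is the set of posets in $\mathfrak{D}$, i.e. reflexive, antisymmetric, transitive digraphs. - $\mathfrak{P}^*=\{P^*:P\in\mathfrak{P}\}$. Schemes: - An S-scheme from $R$ to $S$ with respect to $\mathfrak{D}'$ is a family $\rho=(\rho_G)_{G\in\mathfrak{D}'}$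 of maps $\rho_G:\mathcal{S}(G,R)\to\mathcal{S}(G,S)$. It is strong if every $\rho_G$ is injective. - A Hom-scheme is a family of maps $\rho'_G:\mathcal{H}(G,R)\to\mathcal{H}(G,S)$, $G\in\mathfrak{D}'$, and is strong if every $\rho'_G$ is injective. - A Hom-scheme is a $\Gamma$-scheme if $\Gamma_\xi(v)=\Gamma_{\rho'_G(\xi)}(v)$ for all $G\in\mathfrak{D}'$, $\xi\in\mathcal{H}(G,R)$, $v\in V(G)$. Here $\Gamma_\xi(v)$ denotes the connectivity component of $v$ in the subdigraph of $G$ induced on $\xi^{-1}(\xi(v))$. Auxiliary data: - $\mathcal{E}(R),\mathcal{E}(S)$ are finite digraphs with vertex sets $\mathcal{E}_o(R),\mathcal{E}_o(S)$. - $\phi_R\in\mathcal{S}(\mathcal{E}(R),R)$ and $\phi_S\in\mathcal{S}(\mathcal{E}(S),S)$. - $\alpha^R$ is an S-scheme from $R$ to $\mathcal{E}(R)$ with $\phi_R\circ\alpha^R_{G,\xi}=\xi$ for all $G\in\mathfrak{D}'$ and $\xi\in\mathcal{S}(G,R)$. - $\alpha^S$ is an S-scheme from $S$ to $\mathcal{E}(S)$ with $\phi_S\circ\alpha^S_{G,\zeta}=\zeta$ for all $G\in\mathfrak{D}'$ and $\zeta\in\mathcal{S}(G,S)$. Induced schemes and conditions: - For a strict homomorphism $\epsilon:\mathcal{E}(R)\to\mathcal{E}(S)$, put $\eta_G(\xi)=\phi_S\circ\epsilon\circ\alpha^R_{G,\xi}$. $\rho$ is induced by $\epsilon$ if $\rho_G(\xi)=\eta_G(\xi)$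 for all $G\in\mathfrak{D}'$ and $\xi\in\mathcal{S}(G,R)$. - $\epsilon$ fulfills Condition 1 if $\alpha^S_{G,\eta_G(\xi)}=\epsilon\circ\alpha^R_{G,\xi}$ for all $G\in\mathfrak{D}'$ and $\xi\in\mathcal{S}(G,R)$. - ERD means $\mathcal{E}(R)\in\mathfrak{D}'$. AID means that ERD holds and $\alpha^R_{\mathcal{E}(R),\phi_R}=\mathrm{id}_{\mathcal{E}_o(R)}$. *)

(* Defs.v *)
From HB Require Import structures.
From mathcomp Require Import all_boot.

Set Implicit Arguments.
Unset Strict Implicit.
Unset Printing Implicit Defensive.

Record digraph := Digraph {
  vertex :> finType;
  arc : rel vertex;
  vertex_gt0 : 0 < #|vertex|
}.

Definition loopless (G : digraph) : digraph :=
  @Digraph G [rel x y | (x != y) && arc x y] (vertex_gt0 G).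

(* A walk v_0, ..., v_I is given as v_0 together with the sequence
   p = [:: v_1; ...; v_I]; I >= 1 says that p is nonempty. *)
Definition closed_walk (G : digraph) (v : G) (p : seq G) : bool :=
  [&& p != [::], path (@arc G) v p & last v p == v].

Definition is_poset (G : digraph) : Prop :=
  [/\ reflexive (@arc G), antisymmetric (@arc G) & transitive (@arc G)].

Definition isomorphic (G H : digraph) : Prop :=
  exists2 f : G -> H,
    bijective f & forall x y : G, arc (f x) (f y) = arc x y.

Definition digraph_class := digraph -> Prop.

Definition representative_system (D : digraph_class) : Prop :=
  forall G : digraph, exists! H : digraph, D H /\ isomorphic G H.

(* Membership of a digraph in a class of representatives, after the usual
   identification of a digraph with its representative. *)
Definition in_upto_iso (G : digraph) (C : digraph_class) : Prop :=
  exists2 H : digraph, C H & isomorphic G H.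

Definition class_Ta (D : digraph_class) : digraph_class :=
  fun G => D G /\ forall (v : loopless G) p, ~~ closed_walk v p.

Definition class_P (D : digraph_class) : digraph_class :=
  fun G => D G /\ is_poset G.

(* P^* need not itself be a representative, hence the isomorphism. *)
Definition class_Pstar (D : digraph_class) : digraph_class :=
  fun G => D G /\ exists2 P : digraph, class_P D P & isomorphic G (loopless P).

Definition homomorphic (G H : digraph) (f : G -> H) : bool :=
  [forall v, forall w, arc v w ==> arc (f v) (f w)].

(* For a homomorphism the image of an arc is an arc, so only properness of
   the image has to be required. *)
Definition proper_preserving (G H : digraph) (f : G -> H) : bool :=
  [forall v, forall w, arc v w && (v != w) ==> (f v != f w)].

Record hom (G H : digraph) := Hom {
  hom_val :> {ffun G -> H};
  hom_valP : homomorphic hom_val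
}.

HB.instance Definition _ (G H : digraph) := [isSub for @hom_val G H].

Record shom (G H : digraph) := SHom {
  shom_val :> hom G H;
  shom_valP : proper_preserving shom_val
}.

HB.instance Definition _ (G H : digraph) := [isSub for @shom_val G H].

Lemma comp_homP (G H K : digraph) (g : hom H K) (f : hom G H) :
  homomorphic [ffun v => g (f v)].
Proof.
apply/forallP => v; apply/forallP => w; apply/implyP => vw; rewrite !ffunE.
have /forallP/(_ v)/forallP/(_ w)/implyP/(_ vw) fvw := hom_valP f.
by have /forallP/(_ (f v))/forallP/(_ (f w))/implyP/(_ fvw) := hom_valP g.
Qed.

Definition comp_hom (G H K : digraph) (g : hom H K) (f : hom G H) : hom G K :=
  Hom (comp_homP g f).

Lemma comp_shomP (G H K : digraph) (g : shom H K) (f : shom G H) :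
  proper_preserving (comp_hom g f).
Proof.
apply/forallP => v; apply/forallP => w; apply/implyP => vw; rewrite !ffunE.
have /forallP/(_ v)/forallP/(_ w)/implyP/(_ vw) fvw := shom_valP f.
have /forallP/(_ (f v))/forallP/(_ (f w))/implyP := shom_valP g; apply.
rewrite fvw andbT; have /andP[avw _] := vw.
by have /forallP/(_ v)/forallP/(_ w)/implyP/(_ avw) := hom_valP f.
Qed.

Definition comp_shom (G H K : digraph) (g : shom H K) (f : shom G H) :
    shom G K :=
  SHom (comp_shomP g f).

(* Families indexed by the members of D'; nothing is required of a digraph
   outside D', hence the membership argument. *)
Definition s_scheme (D' : digraph_class) (R S : digraph) :=
  forall G : digraph, D' G -> shom G R -> shom G S.

Definition hom_scheme (D' : digraph_class) (R S : digraph) :=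
  forall G : digraph, D' G -> hom G R -> hom G S.

Definition strong_s_scheme (D' : digraph_class) (R S : digraph)
    (rho : s_scheme D' R S) : Prop :=
  forall (G : digraph) (hG : D' G), injective (rho G hG).

Definition strong_hom_scheme (D' : digraph_class) (R S : digraph)
    (rho : hom_scheme D' R S) : Prop :=
  forall (G : digraph) (hG : D' G), injective (rho G hG).

(* The connectivity component of v (with respect to the underlying undirected
   graph) in the subdigraph of G induced on X, for v in X. *)
Definition component (G : digraph) (X : {set G}) (v : G) : {set G} :=
  [set w | connect [rel x y | [&& x \in X, y \in X & arc x y || arc y x]] v w].

Definition Gamma (G H : digraph) (xi : hom G H) (v : G) : {set G} :=
  component [set x | xi x == xi v] v.

Definition gamma_scheme (D' : digraph_class) (R S : digraph)
    (rho : hom_scheme D' R S) : Prop :=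
  forall (G : digraph) (hG : D' G) (xi : hom G R) (v : G),
    Gamma xi v = Gamma (rho G hG xi) v.

Definition extends (D' : digraph_class) (R S : digraph)
    (rho' : hom_scheme D' R S) (rho : s_scheme D' R S) : Prop :=
  forall (G : digraph) (hG : D' G) (xi : shom G R),
    rho' G hG xi = rho G hG xi :> hom G S.

Definition section_scheme (D' : digraph_class) (R E : digraph)
    (phi : shom E R) (alpha : s_scheme D' R E) : Prop :=
  forall (G : digraph) (hG : D' G) (xi : shom G R),
    comp_shom phi (alpha G hG xi) = xi.

Definition eta (D' : digraph_class) (R S ER ES : digraph)
    (alphaR : s_scheme D' R ER) (phiS : shom ES S) (eps : shom ER ES) :
    s_scheme D' R S :=
  fun G hG xi => comp_shom phiS (comp_shom eps (alphaR G hG xi)).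

Definition induced_by (D' : digraph_class) (R S ER ES : digraph)
    (alphaR : s_scheme D' R ER) (phiS : shom ES S) (eps : shom ER ES)
    (rho : s_scheme D' R S) : Prop :=
  forall (G : digraph) (hG : D' G) (xi : shom G R),
    rho G hG xi = eta alphaR phiS eps hG xi.

Definition condition1 (D' : digraph_class) (R S ER ES : digraph)
    (alphaR : s_scheme D' R ER) (alphaS : s_scheme D' S ES)
    (phiS : shom ES S) (eps : shom ER ES) : Prop :=
  forall (G : digraph) (hG : D' G) (xi : shom G R),
    alphaS G hG (eta alphaR phiS eps hG xi) = comp_shom eps (alphaR G hG xi).

Definition star_star (D' : digraph_class) (R S ER ES : digraph)
    (alphaR : s_scheme D' R ER) (alphaS : s_scheme D' S ES)
    (rho : s_scheme D' R S) : Prop :=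
  forall (G H : digraph) (hG : D' G) (hH : D' H)
      (xi : shom G R) (zeta : shom H R) (v : G) (w : H),
    alphaR G hG xi v = alphaR H hH zeta w ->
    alphaS G hG (rho G hG xi) v = alphaS H hH (rho H hH zeta) w.

(* Main.v *)
From mathcomp Require Import all_boot.
From Stdlib Require Import ClassicalEpsilon.
Require Import Defs.

Set Implicit Arguments.
Unset Strict Implicit.
Unset Printing Implicit Defensive.

(* Part (3): a homomorphism xi from G to R factors as xi = xib o pi, where pi
   contracts the components Gamma_xi(v) and xib is strict. Put
   rho'(xi) := rho(xib) o pi. Since sigma o pi has the same components
   for every strict sigma, rho' is a Gamma-scheme. Conversely, the contraction
   pi is determined by these components, so rho'(xi) determines first pi and
   then, as rho is strong and pi is onto, also xib. A quotient of a poset need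
   not be transitive, but if R is a poset, xib stays strict on its transitive
   closure; if R is in P^*, every homomorphism into R is strict. *)

(** * Homomorphisms and strict homomorphisms *)

Lemma hom_arc (G H : digraph) (f : hom G H) (v w : G) :
  arc v w -> arc (f v) (f w).
Proof. by have /forallP/(_ v)/forallP/(_ w)/implyP := hom_valP f. Qed.

Lemma proper_preservingP (G H : digraph) (f : G -> H) :
  reflect (forall v w, arc v w -> f v = f w -> v = w) (proper_preserving f).
Proof.
apply: (iffP forallP) => [pf v w vw fvw|inj_f v].
  apply/eqP; have /forallP/(_ w)/implyP := pf v.
  by rewrite vw fvw eqxx; case: eqP => //= _ /(_ isT).
apply/forallP => w; apply/implyP => /andP[vw]; apply: contra_neq; exact: inj_f.
Qed.

Lemma shom_arc_inj (G H : digraph) (f : shom G H) (v w : G) :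
  arc v w -> f v = f w -> v = w.
Proof. exact: (proper_preservingP _ (shom_valP f)). Qed.

Lemma eq_hom (G H : digraph) (f g : hom G H) : f =1 g -> f = g.
Proof. by move=> fg; apply/val_inj/ffunP. Qed.

Lemma eq_shom (G H : digraph) (f g : shom G H) : f =1 g -> f = g.
Proof. by move=> fg; apply/val_inj/eq_hom. Qed.

Lemma shom_ex (G H : digraph) (f : G -> H) :
    (forall v w, arc v w -> arc (f v) (f w)) ->
    (forall v w, arc v w -> f v = f w -> v = w) ->
  exists f' : shom G H, f' =1 f.
Proof.
move=> f_arc f_inj; pose g := [ffun v => f v].
have hg : homomorphic g.
  apply/forallP => v; apply/forallP => w; apply/implyP => vw.
  by rewrite !ffunE f_arc.
have sg : proper_preserving (Hom hg).
  by apply/proper_preservingP => v w vw; rewrite !ffunE; apply: f_inj.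
by exists (SHom sg) => v; rewrite /= ffunE.
Qed.

Lemma id_homP (G : digraph) : homomorphic [ffun v : G => v].
Proof. by apply/forallP => v; apply/forallP => w; rewrite !ffunE implybb. Qed.

Definition id_hom (G : digraph) : hom G G := Hom (id_homP G).

Lemma isomorphic_shom (G H : digraph) : isomorphic G H ->
  exists f : shom G H, exists2 g : shom H G, cancel f g & cancel g f.
Proof.
case=> f [g fK gK] f_arc.
have [|v w _ /(can_inj fK) //|f' f'E] := @shom_ex G H f.
  by move=> v w; rewrite f_arc.
have [|v w _ /(can_inj gK) //|g' g'E] := @shom_ex H G g.
  by move=> v w vw; rewrite -f_arc !gK.
by exists f', g' => v; rewrite f'E g'E.
Qed.

(** * Components of fibres *)

(** A walk whose steps preserve the value of [xi] never leaves the fibre of its start. The new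
    relation is symmetric and free of [v], so components of different vertices become comparable. *)
Lemma mem_Gamma (G H : digraph) (xi : hom G H) (v w : G) :
  (w \in Gamma xi v) =
  connect [rel x y | (arc x y || arc y x) && (xi x == xi y)] v w.
Proof.
rewrite inE; apply/idP/idP.
  apply: connect_sub => x y /= /and3P[]; rewrite !inE => /eqP xv /eqP yv a.
  by apply: connect1; rewrite /= a xv yv eqxx.
case/connectP => p; elim/last_ind: p w => [|p y IHp] w /=; first by move=> _ ->.
rewrite rcons_path last_rcons => /andP[vp /andP[a /eqP e]] ->.
have xi_last : xi (last v p) = xi v.
  by elim: p v vp {IHp a e} => //= z p IHp v /andP[/andP[_ /eqP ->] /IHp].
apply: connect_trans (IHp _ vp erefl) (connect1 _).
by rewrite /= !inE a -e xi_last !eqxx.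
Qed.

Lemma Gamma_refl (G H : digraph) (xi : hom G H) (v : G) : v \in Gamma xi v.
Proof. by rewrite mem_Gamma. Qed.

Lemma Gamma_const (G H : digraph) (xi : hom G H) (v w : G) :
  w \in Gamma xi v -> xi v = xi w.
Proof.
rewrite mem_Gamma => /connectP[p]; elim: p v => [v _ -> //|x p IHp v] /=.
by case/andP=> /andP[_ /eqP ->] /IHp.
Qed.

Lemma eq_Gamma_const (G H : digraph) (xi : hom G H) (v w : G) :
  Gamma xi v = Gamma xi w -> xi v = xi w.
Proof. by move=> e; apply: Gamma_const; rewrite e Gamma_refl. Qed.

Lemma Gamma_arc (G H : digraph) (xi : hom G H) (v w : G) :
  arc v w -> xi v = xi w -> Gamma xi v = Gamma xi w.
Proof.
move=> vw e; apply/setP => x; rewrite !mem_Gamma.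
apply: same_connect => [y z|]; last by apply: connect1; rewrite /= vw e eqxx.
by apply: sym_connect_sym => {}y {}z /=; rewrite orbC eq_sym.
Qed.

Lemma proper_preserving_Gamma (G H : digraph) (xi : hom G H) :
  proper_preserving xi <-> forall v, Gamma xi v = [set v].
Proof.
split=> [/proper_preservingP xi_inj v|Gxi].
  apply/setP => w; rewrite mem_Gamma inE; apply/idP/eqP => [|-> //].
  case/connectP => p; elim: p v => [//|x p IHp v] /= /andP[/andP[a /eqP e]].
  suff -> : v = x by apply: IHp.
  by case/orP: a => a; [apply: xi_inj|exact: esym (xi_inj _ _ a (esym e))].
apply/proper_preservingP => v w vw /(Gamma_arc vw).
by rewrite !Gxi => /set1_inj.
Qed.

(** [pi] sends arcs to arcs, and a strict map identifies the ends of an arc only if they are equal.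
    Hence both composites contract exactly the arcs that [pi] contracts. *)
Lemma Gamma_comp_shom (G Q H K : digraph) (pi : hom G Q)
    (f : shom Q H) (g : shom Q K) (v : G) :
  Gamma (comp_hom f pi) v = Gamma (comp_hom g pi) v.
Proof.
suff E L (h : shom Q L) w : (w \in Gamma (comp_hom h pi) v) =
    connect [rel x y | (arc x y || arc y x) && (pi x == pi y)] v w.
  by apply/setP => w; rewrite !E.
rewrite mem_Gamma; apply: eq_connect => x y /=; rewrite !ffunE.
case: (boolP (_ || _)) => //= a; apply/eqP/eqP => [e|-> //].
case/orP: a => /(hom_arc pi) a; first exact: shom_arc_inj a e.
exact: esym (shom_arc_inj a (esym e)).
Qed.

(** * Acyclicity, posets and transitive closure *)

Lemma acyclic_shom (G H : digraph) (f : shom G H) :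
    (forall (v : loopless H) p, ~~ closed_walk v p) ->
  forall (v : loopless G) p, ~~ closed_walk v p.
Proof.
move=> acH v p; apply: contra (acH (f v) (map f p)).
rewrite /closed_walk => /and3P[p0 vp /eqP lp]; apply/and3P; split.
- by case: (p) p0.
- rewrite path_map; apply: sub_path vp => x y /= /andP[xy a].
  rewrite hom_arc // andbT; apply: contra_neq xy; exact: shom_arc_inj.
- by rewrite (last_map f p v) lp.
Qed.

Lemma isomorphic_poset (G H : digraph) :
  isomorphic G H -> is_poset H -> is_poset G.
Proof.
case=> f [g fK _] f_arc [refl anti trans]; split=> [x|x y|y x z].
- by rewrite -f_arc.
- by rewrite -!f_arc => /anti/(can_inj fK).
- by rewrite -!f_arc; apply: trans.
Qed.

Lemma isomorphic_sym (G H : digraph) : isomorphic G H -> isomorphic H G.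
Proof.
case=> f [g fK gK] f_arc; exists g; first by exists f.
by move=> x y; rewrite -f_arc !gK.
Qed.

(** Since [connect] is reflexive, all loops are added as well. *)
Definition transitive_closure (G : digraph) : digraph :=
  @Digraph G (connect (@arc G)) (vertex_gt0 G).

Lemma transitive_closure_shom (G H : digraph) (f : shom G H) :
  is_poset H -> exists f' : shom (transitive_closure G) H, f' =1 f.
Proof.
case=> refl anti trans.
have f_path v p : path (@arc G) v p -> arc (f v) (f (last v p)).
  elim: p v => [v _|x p IHp v] /=; first exact: refl.
  by case/andP=> /(hom_arc f) vx /IHp; apply: trans.
apply: shom_ex => v w /connectP[p]; first by move=> vp ->; apply: f_path.
(* On a nonempty walk without repeated vertices, equal images of the ends force [f v = f x] by
   antisymmetry. Strictness then gives [v = x], a repetition. *)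
case/shortenP=> -[//|x q] /= /andP[vx xq] /andP[v_xq _] _ -> e.
have xv : arc (f x) (f v) by rewrite e; apply: f_path.
have vx' : v = x.
  by apply: (shom_arc_inj (f := f) vx); apply: anti; rewrite xv hom_arc.
by rewrite vx' mem_head in v_xq.
Qed.

Lemma transitive_closure_poset (G H : digraph) :
  is_poset H -> shom G H -> is_poset (transitive_closure G).
Proof.
move=> posH f0; have [f _] := transitive_closure_shom f0 posH.
have [_ anti _] := posH.
split=> [x|x y /andP[xy yx]|y x z]; [exact: connect0| |exact: connect_trans].
by apply: (shom_arc_inj (f := f) xy); apply: anti; rewrite !hom_arc.
Qed.

(** * Quotient by the fibres of a map *)

Section Quotient.

Variables (G : digraph) (T : finType) (g : G -> T).

(** Restricting to the image of [g] makes the projection onto. For [g = Gamma xi] the vertices are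
    the components themselves. *)
Definition quotient_vertex : finType := {x : T | x \in codom g}.

Definition quotient_proj (v : G) : quotient_vertex :=
  exist _ (g v) (codom_f g v).

Lemma quotient_gt0 : 0 < #|quotient_vertex|.
Proof.
have /card_gt0P[v _] := vertex_gt0 G.
by apply/card_gt0P; exists (quotient_proj v).
Qed.

Definition quotient : digraph :=
  @Digraph quotient_vertex
    [rel x y | [exists v, exists w,
       [&& arc v w, quotient_proj v == x & quotient_proj w == y]]]
    quotient_gt0.

Lemma quotient_projP :
  homomorphic ([ffun v => quotient_proj v] : {ffun G -> quotient}).
Proof.
apply/forallP => v; apply/forallP => w; apply/implyP => vw; rewrite !ffunE.
by apply/existsP; exists v; apply/existsP; exists w; rewrite vw !eqxx.
Qed.

Definition quotient_hom : hom G quotient := Hom quotient_projP.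

Lemma quotient_homE v : quotient_hom v = quotient_proj v.
Proof. by rewrite /= ffunE. Qed.

Lemma quotient_hom_surj (x : quotient) : exists v, quotient_hom v = x.
Proof.
case: x => x /[dup] /codomP[v xE] xg; exists v.
by rewrite quotient_homE; apply: val_inj.
Qed.

End Quotient.

Lemma quotient_Gamma_lift (G R : digraph) (xi zeta : hom G R) :
    Gamma zeta =1 Gamma xi ->
  exists f : shom (quotient (Gamma xi)) R,
    comp_hom f (quotient_hom (Gamma xi)) = zeta.
Proof.
(* [iinv] picks a vertex of the component; the choice is immaterial because [zeta] is constant on
   it. *)
move=> E; pose h (x : quotient (Gamma xi)) := zeta (iinv (valP x)).
have hE v : h (quotient_proj (Gamma xi) v) = zeta v.
  by apply: eq_Gamma_const; rewrite !E f_iinv.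
have [x y|x y|f fE] := @shom_ex _ _ h.
- case/existsP=> v /existsP[w /and3P[vw /eqP <- /eqP <-]].
  by rewrite !hE hom_arc.
- case/existsP=> v /existsP[w /and3P[vw /eqP <- /eqP <-]].
  rewrite !hE => /(Gamma_arc vw); rewrite !E => e; exact: val_inj.
exists f; apply: eq_hom => v.
by rewrite [LHS]ffunE fE quotient_homE hE.
Qed.

(** * Extending a strong S-scheme along contractions *)

Section Extension.

Variables (D' : digraph_class) (R S : digraph) (rho : s_scheme D' R S).

(** Quantifying over every [zeta] with components [gam] lets a single contraction serve all of
    them. *)
Definition factors_all (G Q : digraph) (gam : G -> {set G}) (pi : hom G Q) :=
  (forall x, exists v, pi v = x) /\
  forall zeta : hom G R, Gamma zeta =1 gam ->
    exists f : shom Q R, comp_hom f pi = zeta.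

Record contraction (G : digraph) := Contraction {
  base : digraph;
  base_in : D' base;
  proj : hom G base
}.

Definition id_contraction (G : digraph) (hG : D' G) : contraction G :=
  Contraction hG (id_hom G).

(* Forcing the identity in the strict case makes the scheme built from the
   choice an extension of rho: rho itself is not assumed to be compatible with
   isomorphisms, nor independent of the membership proof. *)
Definition good_contraction (G : digraph) (hG : D' G) (gam : {ffun G -> {set G}})
    (q : contraction G) : Prop :=
  factors_all gam (proj q) /\
  ((forall v, gam v = [set v]) -> q = id_contraction hG).

(** The predicate given to [epsilon] sees [xi] only through its components, so homomorphisms with
    the same components get the same contraction. *)
Definition chosen_contraction (G : digraph) (hG : D' G) (xi : hom G R) :=
  epsilon (inhabits (id_contraction hG))
    (good_contraction hG [ffun v => Gamma xi v]).

(** Strict homomorphisms are served by the identity contraction. *)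
Hypothesis contractible : forall G : digraph, D' G -> forall xi : hom G R,
  ~~ proper_preserving xi ->
  exists2 Q : digraph, D' Q & exists pi : hom G Q, factors_all (Gamma xi) pi.

Lemma chosen_contractionP (G : digraph) (hG : D' G) (xi : hom G R) :
  good_contraction hG [ffun v => Gamma xi v] (chosen_contraction hG xi).
Proof.
apply: epsilon_spec; case: (boolP (proper_preserving xi)) => [sxi|nsxi].
  exists (id_contraction hG); split=> //; split=> [x|zeta E].
    by exists x; rewrite /= ffunE.
  have szeta : proper_preserving zeta.
    apply/proper_preserving_Gamma => v; rewrite E ffunE.
    exact: (proper_preserving_Gamma xi).1.
  by exists (SHom szeta); apply: eq_hom => v; rewrite !ffunE.
have [Q hQ [pi [surj lift]]] := contractible hG nsxi.
exists (Contraction hQ pi); split; first split=> //= zeta E.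
  by apply: lift => v; rewrite E ffunE.
(* If all components were singletons, [xi] would be strict. *)
move=> E; case/negP: nsxi; apply/proper_preserving_Gamma => v.
by rewrite -E ffunE.
Qed.

Lemma gamma_extension : strong_s_scheme rho ->
  exists rho' : hom_scheme D' R S,
    [/\ strong_hom_scheme rho', gamma_scheme rho' & extends rho' rho].
Proof.
move=> strong.
have ex G (hG : D' G) (xi : hom G R) : exists tau : hom G S,
    let q := chosen_contraction hG xi in
    exists2 f : shom (base q) R, comp_hom f (proj q) = xi
                               & tau = comp_hom (rho (base_in q) f) (proj q).
  have [[_ lift] _] := chosen_contractionP hG xi.
  have [v|f fE] := lift xi; first by rewrite ffunE.
  by exists (comp_hom (rho (base_in _) f) (proj (chosen_contraction hG xi))), f.
pose rho' G hG xi := sval (constructive_indefinite_description _ (ex G hG xi)).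
have rho'P G hG xi : let q := chosen_contraction hG xi in
    exists2 f : shom (base q) R, comp_hom f (proj q) = xi
      & rho' G hG xi = comp_hom (rho (base_in q) f) (proj q).
  by rewrite /rho'; case: constructive_indefinite_description.
have gam : gamma_scheme rho'.
  move=> G hG xi v; have [f fE ->] := rho'P G hG xi.
  by rewrite -[in LHS]fE; apply: Gamma_comp_shom.
exists rho'; split=> // [G hG xi zeta e|G hG xi].
  have [f fE] := rho'P G hG xi; have [g gE] := rho'P G hG zeta; rewrite -e.
  (* Equal images under [rho'] have equal components, hence so do [xi] and [zeta]. *)
  have qE : chosen_contraction hG zeta = chosen_contraction hG xi.
    rewrite /chosen_contraction; congr (epsilon _ (good_contraction _ _)).
    by apply/ffunP => v; rewrite !ffunE (gam G hG xi) e -gam.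
  have [[surj _] _] := chosen_contractionP hG xi.
  move: g gE; rewrite qE => g gE -> rhoE; rewrite -fE -gE.
  (* It remains to see that [f] and [g] have the same image under [rho], which can be tested after
     the surjective projection. *)
  congr (comp_hom (shom_val _) _); apply: (strong _ (base_in _)).
  apply: eq_shom => x; have [v <-] := surj x.
  by have := congr1 (fun h : hom G S => h v) rhoE; rewrite !ffunE.
have [f fE ->] := rho'P G hG xi.
have [_ idq] := chosen_contractionP hG xi.
have {}idq : chosen_contraction hG xi = id_contraction hG.
  apply: idq => v; rewrite ffunE; exact: (proper_preserving_Gamma xi).1 (shom_valP xi) v.
move: f fE; rewrite idq => f fE.
have -> : f = xi by apply: eq_shom => v; rewrite -fE !ffunE.
by apply: eq_hom => v; rewrite !ffunE.
Qed.

End Extension.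

(** * Contractions within the given classes *)

(** Allows a quotient to be replaced by its representative in [D]. *)
Lemma factors_all_iso (R G Q H : digraph) (gam : G -> {set G}) (pi : hom G Q) :
    isomorphic Q H -> factors_all R gam pi ->
  exists pi' : hom G H, factors_all R gam pi'.
Proof.
move=> /isomorphic_shom[f [g fK gK]] [surj lift].
exists (comp_hom f pi); split=> [x|zeta /lift[h hE]].
  by have [v vE] := surj (g x); exists v; rewrite ffunE vE gK.
exists (comp_shom h g); apply: eq_hom => v.
by rewrite -hE !ffunE fK.
Qed.

Lemma quotient_factors_all (R G : digraph) (xi : hom G R) :
  factors_all R (Gamma xi) (quotient_hom (Gamma xi)).
Proof. by split; [exact: quotient_hom_surj|exact: quotient_Gamma_lift]. Qed.

Lemma closure_factors_all (R G Q : digraph) (gam : G -> {set G}) (pi : hom G Q) :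
    is_poset R -> factors_all R gam pi ->
  exists pi' : hom G (transitive_closure Q), factors_all R gam pi'.
Proof.
move=> posR [surj lift].
have hpi : homomorphic (hom_val pi : {ffun G -> transitive_closure Q}).
  apply/forallP => v; apply/forallP => w; apply/implyP => vw.
  exact/connect1/hom_arc.
exists (Hom hpi); split=> [x|zeta /lift[f fE]]; first exact: surj.
have [f' f'E] := transitive_closure_shom f posR.
by exists f'; apply: eq_hom => v; rewrite -fE !ffunE f'E.
Qed.

Theorem theorem4 (D : digraph_class) (repD : representative_system D)
    (D' : digraph_class) (subD : forall G : digraph, D' G -> D G)
    (R S ER ES : digraph) (phiR : shom ER R) (phiS : shom ES S)
    (alphaR : s_scheme D' R ER) (alphaS : s_scheme D' S ES)
    (secR : section_scheme phiR alphaR) (secS : section_scheme phiS alphaS)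
    (erd : D' ER)
    (aid : forall a : ER, alphaR ER erd phiR a = a)
    (rho : s_scheme D' R S) :
  let eps : shom ER ES := alphaS ER erd (rho ER erd phiR) in
  let hyp2 :=
    [/\ induced_by alphaR phiS eps rho,
        condition1 alphaR alphaS phiS eps
      & forall a b : ER, eps a = eps b -> phiR a = phiR b] in
  [/\ (induced_by alphaR phiS eps rho /\ condition1 alphaR alphaS phiS eps
       <-> star_star alphaR alphaS rho),
      (hyp2 -> strong_s_scheme rho /\ star_star alphaR alphaS rho)
    & (hyp2 ->
       [\/ (forall G : digraph, D' G <-> D G) /\ in_upto_iso R D,
           (forall G : digraph, class_Ta D G -> D' G)
             /\ in_upto_iso R (class_Ta D),
           (forall G : digraph, D' G <-> class_P D G)
             /\ in_upto_iso R (class_P D)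
         | (forall G : digraph, D' G <-> class_Pstar D G)
             /\ in_upto_iso R (class_Pstar D)] ->
       exists rho' : hom_scheme D' R S,
         [/\ strong_hom_scheme rho', gamma_scheme rho' & extends rho' rho])].
Proof.
move=> eps hyp2.
have starP : induced_by alphaR phiS eps rho /\
    condition1 alphaR alphaS phiS eps <-> star_star alphaR alphaS rho.
  split=> [[ind cond] G H hG hH xi zeta v w e|star].
    by rewrite !ind !cond /= !ffunE e.
  have alphaE G (hG : D' G) xi :
      alphaS G hG (rho G hG xi) = comp_shom eps (alphaR G hG xi).
    (* The vertex [v] of [G] is compared with the vertex [alphaR G hG xi v] of [ER], taking [phiR]
       for [zeta]; AID says that both have the same value under [alphaR]. *)
    by apply: eq_shom => v; rewrite ffunE; apply: star; rewrite aid.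
  have ind : induced_by alphaR phiS eps rho.
    by move=> G hG xi; rewrite /eta -alphaE secS.
  by split=> // G hG xi; rewrite -ind alphaE.
have strong : hyp2 -> strong_s_scheme rho.
  (* By Condition 1, [rho G hG xi] determines [eps] after [alphaR G hG xi]; the hypothesis on [eps]
     then recovers [xi] as [phiR] after [alphaR G hG xi]. *)
  case=> ind cond inj G hG xi zeta e; rewrite -(secR G hG xi) -(secR G hG zeta).
  apply: eq_shom => v; rewrite !ffunE; apply: inj.
  have : comp_shom eps (alphaR G hG xi) = comp_shom eps (alphaR G hG zeta).
    by rewrite -!cond -!ind e.
  by move/(congr1 (fun h : shom G ES => h v)); rewrite /= !ffunE.
split=> // [h2|h2 cases]; first by split; [exact: strong|apply/starP; case: h2].
apply: gamma_extension (strong h2) => G hG xi nsxi.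
have quot := quotient_factors_all xi.
(* This strict map from the quotient to [R] pulls acyclicity back to the quotient and makes its
   closure antisymmetric when [R] is a poset. *)
have [f _] := quot.2 xi (frefl _).
case: cases => [[D'E _]|[Ta [H [_ acH] RH]]|[D'E [H [_ posH] RH]]|
                [_ [H [_ [P _ HP]] RH]]].
- have [K [[DK QK] _]] := repD (quotient (Gamma xi)).
  by exists K; [exact/D'E|exact: factors_all_iso quot].
- have [K [[DK QK] _]] := repD (quotient (Gamma xi)).
  exists K; last exact: factors_all_iso quot.
  have [_ [k _ _]] := isomorphic_shom QK; have [r _] := isomorphic_shom RH.
  by apply: Ta; split=> //; apply: acyclic_shom (comp_shom r (comp_shom f k)) acH.
- have posR := isomorphic_poset RH posH.
  have [pi {}quot] := closure_factors_all posR quot.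
  have [K [[DK QK] _]] := repD (transitive_closure (quotient (Gamma xi))).
  exists K; last exact: factors_all_iso quot.
  apply/D'E; split=> //; apply: isomorphic_poset (isomorphic_sym QK) _.
  exact: transitive_closure_poset posR f.
(* Here [R] has no loops, whereas an arc with identified ends would be sent to a loop; so [xi] is
   strict after all. *)
- have [r _ r_arc] := RH; have [p _ p_arc] := HP.
  case/negP: nsxi; apply/proper_preservingP => v w /(hom_arc xi) + e.
  by rewrite e -r_arc -p_arc /= eqxx.
Qed.
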